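(* Let $(\mathcal C,U)$ be a topological concrete category and $\iota:\mathcal C_{obs}\to\mathcal C$ an observation functor. Let $\mathbf{DSM}$, $\mathbf{DSMO}$ be the categories of discrete-time (time $\mathbb N_0$) dynamical systems with measurements, respectively with measurements along orbits, and $\mathbf{Seq}$ the category of subshifts in $\mathcal C$. Then the correspondences $$\mathrm{Obs}:\mathbf{DSM}\to\mathbf{Seq},\quad(\Omega,\Phi,\phi)\mapsto\operatorname{im}\xi_{(\Omega,\Phi,\phi)},\qquad \mathrm{Obs}:\mathbf{DSMO}\to\mathbf{Seq},\quad(\Omega,\Phi,\phi,\omega)\mapsto\operatorname{im}\bigl(\xi_{(\Omega,\Phi,\phi)}|_{O(\omega;\Phi)}\bigr),$$ each image being endowed with the endomorphism $\sigma$ induced by the shift of $(\iota Y)^{\mathbb N_0}$, and each morphism $(h,A)$ (respectively $(g,h,A)$) being sent to the morphism it induces between the images, are functors.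
   Context: Topological concrete category: a category $\mathcal C$ with a faithful functor $U:\mathcal C\to\mathbf{Set}$ such that for every set $X$, every family $(\Omega_i)_{i\in I}$ of objects and maps $f_i:X\to U\Omega_i$, there is an initial lift: an object $\bar\Omega$ with $U\bar\Omega=X$ and morphisms $g_i:\bar\Omega\to\Omega_i$ with $Ug_i=f_i$, such that whenever $\phi:U\Omega'\to X$ is a map and $g_i':\Omega'\to\Omega_i$ are morphisms with $Ug'_i=f_i\circ\phi$ for all $i$, there is a unique $\psi:\Omega'\to\bar\Omega$ with $U\psi=\phi$ and $g_i'=g_i\circ\psi$. (Final lifts exist dually.) Then $\mathcal C$ is complete and cocomplete, $U$ preserves limits, and monomorphisms (epimorphisms) are the morphisms with injective (surjective) underlying map. For $f:X\to Y$, $\operatorname{im}f$ is the object with underlying set the image of $Uf$ with the final structure for $UX\to\operatorname{im}(Uf)$; this gives $X\twoheadrightarrow\operatorname{im}f\hookrightarrow Y$. Observation functor: a category $\mathcal C_{obs}$ and a functor $\iota:\mathcal C_{obs}\to\mathcal C$ such that (i) $\mathcal C_{obs}$ has finite products and $\iota$ preserves them; (ii) for every $\Omega\in\mathcal C_{obs}$ and every monomorphism $A\hookrightarrow\iota\Omega$ in $\mathcal C$ there is $A'\in\mathcal C_{obs}$ with $A=\iota A'$. $\mathbf{DSM}$ (time $\mathbb N_0$): objects $(\Omega,\Phi,\phi)$ with $\Phi:\Omega\to\Omega$ and $\phi:\Omega\to\iota Y$ in $\mathcal C$, $Y\in\mathcal C_{obs}$; morphisms to $(\Omega',\Phi',\phi')$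 are pairs $(h,A)$, $h:\Omega\to\Omega'$ in $\mathcal C$, $A:Y\to Y'$ in $\mathcal C_{obs}$, with $h\Phi=\Phi'h$ and $(\iota A)\phi=\phi'h$. $\mathbf{DSMO}$: objects $(\Omega,\Phi,\phi,\omega)$ with in addition a $\mathcal C$-morphism $\omega:X\to\Omega$; morphisms $(g,h,A)$ with $(h,A)$ as before and $g:X\to X'$ an injection with $h\omega=\omega'g$. $\xi_{(\Omega,\Phi,\phi)}:\Omega\to(\iota Y)^{\mathbb N_0}$ is the unique morphism with $\pi_n\circ\xi=\phi\circ\Phi^n$ for all $n\in\mathbb N_0$. The orbit $O(\omega;\Phi)\hookrightarrow\Omega$ is the subobject with underlying set $\bigcup_{n\ge0}(U\Phi)^n(\operatorname{im}U\omega)$ and initial structure from the inclusion; it is forward invariant under $\Phi$. For an object $\mathbb A$ the shift $\sigma:\mathbb A^{\mathbb N_0}\to\mathbb A^{\mathbb N_0}$ is the unique morphism with $\pi_n\sigma=\pi_{n+1}$. A subshift on $\mathbb A$ is a subobject $m:S\hookrightarrow\mathbb A^{\mathbb N_0}$ such that the inclusion $\operatorname{im}(\sigma m)\hookrightarrow\mathbb A^{\mathbb N_0}$ factors through $m$; it carries $\sigma|_S:S\to S$ with $m\circ\sigma|_S=\sigma\circ m$. $\mathbf{Seq}$ has subshifts as objects and, as morphisms $S\to S'$, the $\mathcal C$-morphisms $f$ with $f\circ\sigma|_S=\sigma|_{S'}\circ f$. The morphism induced between the images by $(h,A)$ is the unique $\mathrm{Obs}(h,A):\operatorname{im}\xi\to\operatorname{im}\xi'$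 compatible with $h$ along the epimorphisms $\Omega\twoheadrightarrow\operatorname{im}\xi$, $\Omega'\twoheadrightarrow\operatorname{im}\xi'$ and with $(\iota A)^{\mathbb N_0}$ along the inclusions; for $(g,h,A)$ one uses the restriction of $h$ to the orbits. *)

(* Defs.v *)
From mathcomp Require Import all_boot boolp.

Set Implicit Arguments.
Unset Strict Implicit.
Unset Printing Implicit Defensive.

Declare Scope cat_scope.
Delimit Scope cat_scope with cat.
Local Open Scope cat_scope.

Record category := Category {
  obj :> Type;
  hom : obj -> obj -> Type;
  idh : forall a, hom a a;
  hcomp : forall a b c, hom b c -> hom a b -> hom a c;
  hcompA : forall a b c d (h : hom c d) (g : hom b c) (f : hom a b),
    hcomp h (hcomp g f) = hcomp (hcomp h g) f;
  hcomp1h : forall a b (f : hom a b), hcomp (idh b) f = f;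
  hcomph1 : forall a b (f : hom a b), hcomp f (idh a) = f }.

Arguments hom {C} a b : rename.
Arguments idh {C} a : rename.
Arguments hcomp {C a b c} g f : rename.

Reserved Notation "g ∘ f" (at level 40, left associativity).
Notation "g ∘ f" := (hcomp g f) : cat_scope.

Definition is_functor (C D : category) (F0 : C -> D)
    (F1 : forall a b : C, hom a b -> hom (F0 a) (F0 b)) : Prop :=
  (forall a, F1 a a (idh a) = idh (F0 a)) /\
  (forall a b c (g : hom b c) (f : hom a b), F1 a c (g ∘ f) = F1 b c g ∘ F1 a b f).

Record functor (C D : category) := Functor {
  fobj :> C -> D;
  fmap : forall a b : C, hom a b -> hom (fobj a) (fobj b);
  functorP : is_functor fmap }.

Arguments fmap {C D} F {a b} f : rename.

Definition faithful (C D : category) (F : functor C D) : Prop :=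
  forall a b : C, injective (fun f : hom a b => fmap F f).

Definition mono (C : category) (a b : C) (m : hom a b) : Prop :=
  forall (c : C) (f g : hom c a), m ∘ f = m ∘ g -> f = g.

(* The universe of sets: it is fixed once and for all, and is the one in which
   underlying sets and index sets of families live. *)
Definition small : Type := Type.

Definition Sets : category :=
  @Category small (fun X Y : small => X -> Y) (fun X x => x)
    (fun X Y Z g f => g \o f)
    (fun _ _ _ _ _ _ _ => erefl) (fun _ _ _ => erefl) (fun _ _ _ => erefl).

Definition is_product (C : category) (I : small) (F : I -> C) (P : C)
    (pi : forall i, hom P (F i)) : Prop :=
  forall (B : C) (f : forall i, hom B (F i)),
    exists! u : hom B P, forall i, pi i ∘ u = f i.

Definition cast (X Y : small) (e : X = Y) (x : X) : Y :=
  match e in _ = Z return Z with erefl => x end.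

Section Lifts.
Variables (C : category) (U : functor C Sets).

Definition is_initial_lift (X : small) (I : small) (Om : I -> C)
    (f : forall i, X -> U (Om i)) (L : C) (e : U L = X)
    (g : forall i, hom L (Om i)) : Prop :=
  (forall i, fmap U (g i) = f i \o cast e) /\
  (forall (Om' : C) (phi : U Om' -> X) (g' : forall i, hom Om' (Om i)),
    (forall i, fmap U (g' i) = f i \o phi) ->
    exists! psi : hom Om' L,
      cast e \o fmap U psi = phi /\ forall i, g' i = g i ∘ psi).

Definition is_final_lift (X : small) (I : small) (Om : I -> C)
    (f : forall i, U (Om i) -> X) (L : C) (e : U L = X)
    (g : forall i, hom (Om i) L) : Prop :=
  (forall i, cast e \o fmap U (g i) = f i) /\
  (forall (Om' : C) (phi : X -> U Om') (g' : forall i, hom (Om i) Om'),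
    (forall i, fmap U (g' i) = phi \o f i) ->
    exists! psi : hom L Om',
      fmap U psi = phi \o cast e /\ forall i, g' i = psi ∘ g i).

End Lifts.

(* Families are indexed by sets.  Final lifts would follow from initial lifts of
   class-indexed families, but not from those of set-indexed families alone, so
   both halves of the (self-dual) notion are recorded. *)
Record topcat := TopCat {
  tc_cat :> category;
  forget : functor tc_cat Sets;
  forget_faithful : faithful forget;
  initial_lift : forall (X I : small) (Om : I -> tc_cat)
    (f : forall i, X -> forget (Om i)),
    exists (L : tc_cat) (e : forget L = X) (g : forall i, hom L (Om i)),
      is_initial_lift f e g;
  final_lift : forall (X I : small) (Om : I -> tc_cat)
    (f : forall i, forget (Om i) -> X),
    exists (L : tc_cat) (e : forget L = X) (g : forall i, hom (Om i) L),
      is_final_lift f e g }.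

Arguments forget T : rename.

Section Constructions.
Variable T : topcat.
Local Notation U := (forget T).

Lemma fmap_comp (C D : category) (F : functor C D) (a b c : C) (g : hom b c)
  (f : hom a b) : fmap F (g ∘ f) = fmap F g ∘ fmap F f.
Proof. by case: (functorP F) => _ ->. Qed.

Lemma has_products (I : small) (F : I -> T) :
  exists (P : T) (pi : forall i, hom P (F i)), is_product pi.
Proof.
have [P [e [pi [Upi uni]]]] :=
  @initial_lift T (forall i, U (F i)) I F (fun i x => x i).
exists P, pi => B f.
have [|u [[Uu fu] u_uniq]] := uni B (fun b i => fmap U (f i) b) f; first by [].
exists u; split=> [i|v vf]; first by rewrite fu.
apply: u_uniq; split=> [|i]; last by rewrite vf.
apply/funext => b; apply: functional_extensionality_dep => i /=.
by rewrite -vf fmap_comp /= Upi.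
Qed.

(* The universal properties determine [pow], [im] and [orbit_obj] only up to
   isomorphism; fixed representatives are selected by choice. *)
Definition pow (A : T) : T := projT1 (cid (has_products (fun _ : nat => A))).

Definition proj (A : T) (n : nat) : hom (pow A) A :=
  projT1 (cid (projT2 (cid (has_products (fun _ : nat => A))))) n.

Lemma powP (A : T) : is_product (@proj A).
Proof. exact: projT2 (cid (projT2 (cid (has_products (fun _ : nat => A))))). Qed.

Definition tuple_hom (B A : T) (f : nat -> hom B A) : hom B (pow A) :=
  projT1 (cid (powP f)).

Lemma proj_tuple (B A : T) (f : nat -> hom B A) n : proj A n ∘ tuple_hom f = f n.
Proof. by rewrite /tuple_hom; case: cid => u [/= + _]; exact. Qed.

Definition shift (A : T) : hom (pow A) (pow A) := tuple_hom (fun n => proj A n.+1).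

Definition pow_hom (A B : T) (f : hom A B) : hom (pow A) (pow B) :=
  tuple_hom (fun n => f ∘ proj A n).

Section Image.
Variables (X Y : T) (f : hom X Y).

Definition im_set : small := {y : U Y | exists x : U X, fmap U f x = y}.

Definition im_corestr (x : U X) : im_set :=
  exist _ (fmap U f x) (ex_intro _ x erefl).

Let im_lift := @final_lift T im_set unit (fun=> X) (fun=> im_corestr).

Definition im : T := projT1 (cid im_lift).

Definition im_eq : U im = im_set := projT1 (cid (projT2 (cid im_lift))).

Let im_lift_eq := projT2 (cid (projT2 (cid im_lift))).

Definition im_epi : hom X im := projT1 (cid im_lift_eq) tt.

Lemma im_final :
  is_final_lift (fun _ : unit => im_corestr) im_eq (fun=> im_epi).
Proof.
have := projT2 (cid im_lift_eq); rewrite -/im_eq /im_epi.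
move: (projT1 (cid im_lift_eq)) => g.
by have <- : g = fun=> g tt by apply/funext => -[].
Qed.

Lemma im_incl_ex : exists! m : hom im Y,
  fmap U m = (fun y : im_set => sval y) \o cast im_eq /\ f = m ∘ im_epi.
Proof.
have [_ uni] := im_final.
have [|m [[Um fm] m_uniq]] := uni Y (fun y => sval y) (fun=> f); first by [].
exists m; split=> [|m' [Um' fm']]; first by split=> //; exact: fm tt.
by apply: m_uniq.
Qed.

Definition im_incl : hom im Y := projT1 (cid im_incl_ex).

Lemma im_inclE : fmap U im_incl = (fun y : im_set => sval y) \o cast im_eq.
Proof. by case: (projT2 (cid im_incl_ex)) => -[]. Qed.

Lemma im_fact : im_incl ∘ im_epi = f.
Proof. by case: (projT2 (cid im_incl_ex)) => -[_ <-]. Qed.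

End Image.

Section Orbit.
Variables (X Om : T) (w : hom X Om) (Phi : hom Om Om).

Definition orbit_set : small :=
  {x : U Om | exists (n : nat) (y : U X), x = iter n (fmap U Phi) (fmap U w y)}.

Let orbit_lift :=
  @initial_lift T orbit_set unit (fun=> Om) (fun=> fun x : orbit_set => sval x).

Definition orbit_obj : T := projT1 (cid orbit_lift).

Definition orbit_eq : U orbit_obj = orbit_set :=
  projT1 (cid (projT2 (cid orbit_lift))).

Let orbit_lift_eq := projT2 (cid (projT2 (cid orbit_lift))).

Definition orbit_incl : hom orbit_obj Om := projT1 (cid orbit_lift_eq) tt.

Lemma orbit_initial :
  is_initial_lift (fun _ : unit => fun x : orbit_set => sval x) orbit_eq
    (fun=> orbit_incl).
Proof.
have := projT2 (cid orbit_lift_eq); rewrite -/orbit_eq /orbit_incl.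
move: (projT1 (cid orbit_lift_eq)) => g.
by have <- : g = fun=> g tt by apply/funext => -[].
Qed.

End Orbit.

(* Subobjects are represented by monomorphisms, not by their isomorphism classes. *)
Definition is_subshift (A S : T) (m : hom S (pow A)) : Prop :=
  mono m /\
  exists u : hom (im (shift A ∘ m)) S, m ∘ u = im_incl (shift A ∘ m).

Record subshift := Subshift {
  ss_base : T;
  ss_obj : T;
  ss_incl : hom ss_obj (pow ss_base);
  ss_inv : is_subshift ss_incl }.

Lemma ss_shift_ex (S : subshift) : exists s : hom (ss_obj S) (ss_obj S),
  ss_incl S ∘ s = shift (ss_base S) ∘ ss_incl S.
Proof.
have [_ [u mu]] := ss_inv S; exists (u ∘ im_epi _).
by rewrite hcompA mu im_fact.
Qed.

(* Determined by its defining equation, since the inclusion is a monomorphism. *)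
Definition ss_shift (S : subshift) : hom (ss_obj S) (ss_obj S) :=
  projT1 (cid (ss_shift_ex S)).

Lemma ss_shiftE (S : subshift) :
  ss_incl S ∘ ss_shift S = shift (ss_base S) ∘ ss_incl S.
Proof. exact: projT2 (cid (ss_shift_ex S)). Qed.

Record seq_hom (S S' : subshift) := SeqHom {
  sh_hom :> hom (ss_obj S) (ss_obj S');
  sh_equiv : sh_hom ∘ ss_shift S = ss_shift S' ∘ sh_hom }.

Lemma seq_hom_eq (S S' : subshift) (f g : seq_hom S S') :
  sh_hom f = sh_hom g -> f = g.
Proof.
case: f g => [f Ef] [g Eg] /= fg; case: _ / fg Eg => Eg.
by rewrite (Prop_irrelevance Ef Eg).
Qed.

Definition seq_id (S : subshift) : seq_hom S S.
Proof. by exists (idh _); rewrite hcomp1h hcomph1. Defined.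

Definition seq_comp (S S' S'' : subshift) (g : seq_hom S' S'')
  (f : seq_hom S S') : seq_hom S S''.
Proof.
by exists (sh_hom g ∘ sh_hom f);
  rewrite -hcompA sh_equiv hcompA sh_equiv hcompA.
Defined.

Definition Seq : category.
Proof.
exists subshift seq_hom seq_id seq_comp.
- by move=> *; apply: seq_hom_eq; exact: hcompA.
- by move=> *; apply: seq_hom_eq; exact: hcomp1h.
- by move=> *; apply: seq_hom_eq; exact: hcomph1.
Defined.

End Constructions.

Record obs_functor (T : topcat) := ObsFunctor {
  obs_cat : category;
  obs_iota :> functor obs_cat T;
  obs_products : forall (n : nat) (F : 'I_n -> obs_cat),
    exists (P : obs_cat) (pi : forall i, hom P (F i)), is_product pi;
  obs_iota_products : forall (n : nat) (F : 'I_n -> obs_cat) (P : obs_cat)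
    (pi : forall i, hom P (F i)),
    is_product pi -> is_product (fun i => fmap obs_iota (pi i));
  obs_iota_mono : forall (Om : obs_cat) (A : T) (m : hom A (obs_iota Om)),
    mono m -> exists A' : obs_cat, A = obs_iota A' }.

Section DSM.
Variables (T : topcat) (iota : obs_functor T).

Record dsm := Dsm {
  ds_obj : T;
  ds_map : hom ds_obj ds_obj;
  ds_obs : obs_cat iota;
  ds_meas : hom ds_obj (iota ds_obs) }.

Record dsm_hom (D D' : dsm) := DsmHom {
  dh_hom : hom (ds_obj D) (ds_obj D');
  dh_obs : hom (ds_obs D) (ds_obs D');
  dh_equiv : dh_hom ∘ ds_map D = ds_map D' ∘ dh_hom;
  dh_meas : fmap iota dh_obs ∘ ds_meas D = ds_meas D' ∘ dh_hom }.

Lemma dsm_hom_eq (D D' : dsm) (f g : dsm_hom D D') :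
  dh_hom f = dh_hom g -> dh_obs f = dh_obs g -> f = g.
Proof.
case: f g => [f a Ef Ea] [g b Eg Eb] /= fg ab.
case: _ / fg Eg Eb => Eg Eb; case: _ / ab Eb => Eb.
by rewrite (Prop_irrelevance Ef Eg) (Prop_irrelevance Ea Eb).
Qed.

Definition dsm_id (D : dsm) : dsm_hom D D.
Proof.
exists (idh _) (idh _); first by rewrite hcomp1h hcomph1.
by case: (functorP iota) => -> _; rewrite hcomp1h hcomph1.
Defined.

Definition dsm_comp (D D' D'' : dsm) (g : dsm_hom D' D'') (f : dsm_hom D D') :
  dsm_hom D D''.
Proof.
exists (dh_hom g ∘ dh_hom f) (dh_obs g ∘ dh_obs f).
  by rewrite -hcompA dh_equiv hcompA dh_equiv hcompA.
by rewrite fmap_comp -hcompA dh_meas hcompA dh_meas hcompA.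
Defined.

Definition DSM : category.
Proof.
exists dsm dsm_hom dsm_id dsm_comp.
- by move=> *; apply: dsm_hom_eq; exact: hcompA.
- by move=> *; apply: dsm_hom_eq; exact: hcomp1h.
- by move=> *; apply: dsm_hom_eq; exact: hcomph1.
Defined.

Record dsmo := Dsmo {
  do_dsm :> dsm;
  do_init : T;
  do_orb : hom do_init (ds_obj do_dsm) }.

Record dsmo_hom (D D' : dsmo) := DsmoHom {
  oh_hom :> dsm_hom D D';
  oh_init : hom (do_init D) (do_init D');
  oh_inj : injective (fmap (forget T) oh_init);
  oh_orb : dh_hom oh_hom ∘ do_orb D = do_orb D' ∘ oh_init }.

Lemma dsmo_hom_eq (D D' : dsmo) (f g : dsmo_hom D D') :
  oh_hom f = oh_hom g -> oh_init f = oh_init g -> f = g.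
Proof.
case: f g => [f a If Ef] [g b Ig Eg] /= fg ab.
case: _ / fg Eg => Eg; case: _ / ab Ig Eg => Ig Eg.
by rewrite (Prop_irrelevance If Ig) (Prop_irrelevance Ef Eg).
Qed.

Definition dsmo_id (D : dsmo) : dsmo_hom D D.
Proof.
exists (dsm_id D) (idh _); last by rewrite hcomp1h hcomph1.
by case: (functorP (forget T)) => -> _.
Defined.

Definition dsmo_comp (D D' D'' : dsmo) (g : dsmo_hom D' D'')
  (f : dsmo_hom D D') : dsmo_hom D D''.
Proof.
exists (dsm_comp g f) (oh_init g ∘ oh_init f).
  rewrite fmap_comp; apply: inj_comp; exact: oh_inj.
by rewrite /= -hcompA oh_orb hcompA oh_orb hcompA.
Defined.

Definition DSMO : category.
Proof.
exists dsmo dsmo_hom dsmo_id dsmo_comp.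
- move=> *; apply: dsmo_hom_eq; last exact: hcompA.
  by apply: dsm_hom_eq; exact: hcompA.
- move=> *; apply: dsmo_hom_eq; last exact: hcomp1h.
  by apply: dsm_hom_eq; exact: hcomp1h.
- move=> *; apply: dsmo_hom_eq; last exact: hcomph1.
  by apply: dsm_hom_eq; exact: hcomph1.
Defined.

Definition iter_hom (a : T) (f : hom a a) (n : nat) : hom a a :=
  iter n (fun g => f ∘ g) (idh a).

Definition xi (D : dsm) : hom (ds_obj D) (pow (iota (ds_obs D))) :=
  tuple_hom (fun n => ds_meas D ∘ iter_hom (ds_map D) n).

Definition dsmo_orbit (D : dsmo) : T := orbit_obj (do_orb D) (ds_map D).

Definition orbit_in (D : dsmo) : hom (dsmo_orbit D) (ds_obj D) :=
  orbit_incl (do_orb D) (ds_map D).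

Definition xi_orb (D : dsmo) : hom (dsmo_orbit D) (pow (iota (ds_obs D))) :=
  xi D ∘ orbit_in D.

Definition obs_induced (D D' : dsm) (u : dsm_hom D D')
    (k : hom (im (xi D)) (im (xi D'))) : Prop :=
  k ∘ im_epi (xi D) = im_epi (xi D') ∘ dh_hom u /\
  im_incl (xi D') ∘ k = pow_hom (fmap iota (dh_obs u)) ∘ im_incl (xi D).

Definition obs_orb_induced (D D' : dsmo) (u : dsmo_hom D D')
    (k : hom (im (xi_orb D)) (im (xi_orb D'))) : Prop :=
  exists h : hom (dsmo_orbit D) (dsmo_orbit D'),
    orbit_in D' ∘ h = dh_hom u ∘ orbit_in D /\
    k ∘ im_epi (xi_orb D) = im_epi (xi_orb D') ∘ h /\
    im_incl (xi_orb D') ∘ k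
      = pow_hom (fmap iota (dh_obs u)) ∘ im_incl (xi_orb D).

End DSM.

Arguments xi {T iota} D.
Arguments xi_orb {T iota} D.

(* Main.v *)
Require Import Defs.
From mathcomp Require Import all_boot boolp.

Set Implicit Arguments.
Unset Strict Implicit.
Unset Printing Implicit Defensive.

Local Open Scope cat_scope.

(** The theorem is an instance of the functoriality of images in a topological
concrete category.  The corestriction of a morphism to its image is surjective
and final, so it has the diagonal filling property against every morphism that
is injective on underlying sets ([im_diagonal]): the filler exists as a map of
sets, and finality makes it a morphism.

For a family of morphisms [f d] into powers, diagonals give everything.  If the
shift restricts along [f d], meaning that shift ∘ f d = f d ∘ Phi for some Phi,
then it restricts to the image, which is therefore a subshift
([is_subshift_im]).  If a morphism d -> d' of the indexing category acts
compatibly on sources and coordinatewise on targets, it induces a morphism of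
images.  As the inclusion of an image is a monomorphism, the induced morphism is
already determined by its compatibility with the inclusions, that is, by the
action on the targets alone; so it commutes with the shifts, and it is
functorial because the powers are ([im_subshift_functor]).

Two families are of this kind: the xi of systems with measurements, since xi
intertwines Phi with the shift ([shift_xi]) and is natural ([pow_hom_xi]), and
their restrictions to orbits, since Phi and the morphisms of systems map orbits
into orbits ([orbit_restrict]). *)

(** * Transport, faithfulness and powers *)

Lemma cast_sym (X Y : small) (e : X = Y) (y : Y) : cast e (cast (esym e) y) = y.
Proof. by case: _ / e y. Qed.

Lemma cast_inj (X Y : small) (e : X = Y) : injective (cast e).
Proof. by case: _ / e. Qed.

Lemma sval_inj (X : Type) (P : X -> Prop) :
  injective (fun x : {x | P x} => sval x).
Proof. by move=> [x Px] [y Py] /= xy; exact: eq_exist. Qed.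

Section Topcat.
Variable T : topcat.
Local Notation U := (forget T).

Lemma forget_comp (a b c : T) (g : hom b c) (f : hom a b) (x : U a) :
  fmap U (g ∘ f) x = fmap U g (fmap U f x).
Proof. by rewrite fmap_comp. Qed.

Lemma forget_ext (a b : T) (f g : hom a b) : fmap U f =1 fmap U g -> f = g.
Proof. by move=> fg; apply: (@forget_faithful T); apply/funext. Qed.

Lemma inj_mono (a b : T) (m : hom a b) : injective (fmap U m) -> mono m.
Proof.
move=> m_inj c f g mfg; apply: forget_ext => x; apply: m_inj.
by rewrite -!forget_comp mfg.
Qed.

Lemma pow_ext (A B : T) (u v : hom B (pow A)) :
  (forall n, proj A n ∘ u = proj A n ∘ v) -> u = v.
Proof.
move=> uv; have [w [_ w_uniq]] := powP (fun n => proj A n ∘ u).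
by rewrite -(w_uniq u) ?(w_uniq v).
Qed.

Lemma proj_shift (A : T) n : proj A n ∘ shift A = proj A n.+1.
Proof. exact: proj_tuple. Qed.

Lemma proj_pow_hom (A B : T) (f : hom A B) n :
  proj B n ∘ pow_hom f = f ∘ proj A n.
Proof. exact: proj_tuple. Qed.

Lemma pow_hom1 (A : T) : pow_hom (idh A) = idh (pow A).
Proof. by apply: pow_ext => n; rewrite proj_pow_hom hcomp1h hcomph1. Qed.

Lemma pow_hom_comp (A B C : T) (g : hom B C) (f : hom A B) :
  pow_hom (g ∘ f) = pow_hom g ∘ pow_hom f.
Proof.
apply: pow_ext => n.
by rewrite proj_pow_hom hcompA proj_pow_hom -!hcompA proj_pow_hom.
Qed.

Lemma shift_pow_hom (A B : T) (f : hom A B) :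
  shift B ∘ pow_hom f = pow_hom f ∘ shift A.
Proof.
apply: pow_ext => n; rewrite !hcompA proj_shift !proj_pow_hom.
by rewrite -hcompA proj_shift.
Qed.

(** * Images *)

Section Images.
Variables (X Y : T) (f : hom X Y).

Lemma im_incl_inj : injective (fmap U (im_incl f)).
Proof.
by rewrite im_inclE; apply: inj_comp; [exact: sval_inj|exact: cast_inj].
Qed.

Lemma im_incl_mono : mono (im_incl f).
Proof. exact/inj_mono/im_incl_inj. Qed.

Lemma im_epi_surj (y : U (im f)) : exists x, fmap U (im_epi f) x = y.
Proof.
have [x fx] := svalP (cast (im_eq f) y); exists x.
by apply: im_incl_inj; rewrite -forget_comp im_fact fx im_inclE.
Qed.

Lemma im_epi_epi (Z : T) (u v : hom (im f) Z) :
  u ∘ im_epi f = v ∘ im_epi f -> u = v.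
Proof.
move=> uv; apply: forget_ext => y; have [x <-] := im_epi_surj y.
by rewrite -!forget_comp uv.
Qed.

(** The filler sends f x to a x.  This is well defined because m is injective
and m (a x) depends on f x only. *)
Lemma im_diagonal (Z W : T) (m : hom Z W) (a : hom X Z) (b : hom (im f) W) :
  injective (fmap U m) -> m ∘ a = b ∘ im_epi f ->
  exists d : hom (im f) Z, m ∘ d = b.
Proof.
move=> m_inj mab.
pose phi (y : im_set f) : U Z := fmap U a (sval (cid (svalP y))).
have m_phi y : fmap U m (phi y) = fmap U b (cast (esym (im_eq f)) y).
  rewrite /phi; case: cid => /= x fx; rewrite -forget_comp mab forget_comp.
  congr (fmap U b _); apply: im_incl_inj.
  by rewrite -forget_comp im_fact im_inclE /= cast_sym.
have [cast_epi uni] := im_final f.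
have [|d [[_ dE] _]] := uni Z phi (fun=> a).
  move=> i; apply/funext => x; apply: m_inj => /=; rewrite m_phi.
  rewrite -forget_comp mab forget_comp; congr (fmap U b _).
  apply: (@cast_inj _ _ (im_eq f)); rewrite cast_sym.
  exact: (congr1 (fun h => h x) (cast_epi i)).
by exists d; apply: im_epi_epi; rewrite -hcompA -(dE tt).
Qed.

End Images.

Lemma im_map (X Y X' Y' : T) (f : hom X Y) (f' : hom X' Y') (h : hom X X')
    (p : hom Y Y') :
  p ∘ f = f' ∘ h -> exists k, im_incl f' ∘ k = p ∘ im_incl f.
Proof.
move=> pf; apply: (im_diagonal (a := im_epi f' ∘ h)); first exact: im_incl_inj.
by rewrite hcompA im_fact -hcompA im_fact.
Qed.

(** The square of inclusions forces the square of corestrictions, the inclusion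
of the target image being a monomorphism. *)
Lemma im_map_epi (X Y X' Y' : T) (f : hom X Y) (f' : hom X' Y') (h : hom X X')
    (p : hom Y Y') (k : hom (im f) (im f')) :
  p ∘ f = f' ∘ h -> im_incl f' ∘ k = p ∘ im_incl f ->
  k ∘ im_epi f = im_epi f' ∘ h.
Proof.
move=> pf kE; apply: im_incl_mono.
by rewrite hcompA kE -hcompA im_fact pf hcompA im_fact.
Qed.

(** * Subshifts carried by images *)

Lemma is_subshift_im (X A : T) (f : hom X (pow A)) :
  (exists Phi, shift A ∘ f = f ∘ Phi) -> is_subshift (im_incl f).
Proof.
case=> Phi fPhi; split; first exact: im_incl_mono.
have [s sE] := im_map fPhi.
by apply: (im_diagonal (a := s)); [exact: im_incl_inj|rewrite im_fact].
Qed.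

Section SubshiftHom.
Variables (S S' : subshift T) (a : hom (ss_base S) (ss_base S')).
Variable k : hom (ss_obj S) (ss_obj S').
Hypothesis kE : ss_incl S' ∘ k = pow_hom a ∘ ss_incl S.

Lemma subshift_hom_equiv : k ∘ ss_shift S = ss_shift S' ∘ k.
Proof.
have [mS' _] := ss_inv S'; apply: mS'.
by rewrite !hcompA kE ss_shiftE -!hcompA kE ss_shiftE !hcompA shift_pow_hom.
Qed.

End SubshiftHom.

(** The conclusion characterizes the induced morphisms by the inclusions only;
[im_map_epi] recovers their compatibility with the corestrictions for every
h on the sources that makes the square over f d and f d' commute. *)
Lemma im_subshift_functor (D : category) (A : functor D T) (X : D -> T)
    (f : forall d, hom (X d) (pow (A d))) :
  (forall d, exists Phi, shift (A d) ∘ f d = f d ∘ Phi) ->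
  (forall d d' (u : hom d d'), exists h, pow_hom (fmap A u) ∘ f d = f d' ∘ h) ->
  exists (sub : forall d, is_subshift (im_incl (f d)))
         (F : forall d d' : D, hom d d' ->
            @hom (Seq T) (Subshift (sub d)) (Subshift (sub d'))),
    @is_functor D (Seq T) (fun d => Subshift (sub d)) F /\
    (forall d d' (u : hom d d') (k : hom (im (f d)) (im (f d'))),
       im_incl (f d') ∘ k = pow_hom (fmap A u) ∘ im_incl (f d) <->
       k = sh_hom (F d d' u)).
Proof.
move=> f_shift f_nat.
have sub d : is_subshift (im_incl (f d)) by exact: is_subshift_im.
have ex d d' (u : hom d d') : {k : seq_hom (Subshift (sub d)) (Subshift (sub d'))
    | im_incl (f d') ∘ k = pow_hom (fmap A u) ∘ im_incl (f d)}.
  apply: cid; have [h hE] := f_nat _ _ u; have [k kE] := im_map hE.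
  by exists (@SeqHom _ (Subshift (sub d)) (Subshift (sub d')) k
    (@subshift_hom_equiv (Subshift (sub d)) (Subshift (sub d')) _ _ kE)).
exists sub, (fun d d' u => sval (ex d d' u)); split; last first.
  move=> d d' u k; have uE := svalP (ex d d' u); split=> [kE|->//].
  by apply: im_incl_mono; rewrite kE uE.
have [A1 AM] := functorP A.
split=> [d|d d' d'' v u]; apply: seq_hom_eq; apply: im_incl_mono.
  by rewrite (svalP (ex _ _ _)) A1 pow_hom1 hcomp1h hcomph1.
rewrite (svalP (ex _ _ _)) AM pow_hom_comp /= hcompA (svalP (ex _ _ _)).
by rewrite -!hcompA (svalP (ex _ _ _)).
Qed.

(** * Orbits *)

Lemma orbit_inclE (X Om : T) (w : hom X Om) (Phi : hom Om Om) :
  fmap U (orbit_incl w Phi) = (fun x : orbit_set w Phi => sval x) \o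
    cast (orbit_eq w Phi).
Proof. by have [/(_ tt)] := orbit_initial w Phi. Qed.

(** The hypothesis allows any n', and not only n' = n, so that it covers both
morphisms of systems and Phi itself, which raises the exponent by one. *)
Lemma orbit_restrict (X Om X' Om' : T) (w : hom X Om) (Phi : hom Om Om)
    (w' : hom X' Om') (Phi' : hom Om' Om') (h : hom Om Om') :
  (forall n (y : U X), exists n' (y' : U X'),
     fmap U h (iter n (fmap U Phi) (fmap U w y)) =
     iter n' (fmap U Phi') (fmap U w' y')) ->
  exists k, orbit_incl w' Phi' ∘ k = h ∘ orbit_incl w Phi.
Proof.
move=> h_orb.
have hP (x : orbit_set w Phi) : exists n' (y' : U X'),
    fmap U h (sval x) = iter n' (fmap U Phi') (fmap U w' y').
  by case: x => /= x [n [y ->]]; exact: h_orb.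
have [_ uni] := orbit_initial w' Phi'.
have [|k [[_ kE] _]] := uni (orbit_obj w Phi)
  (fun x => exist _ _ (hP (cast (orbit_eq w Phi) x)))
  (fun=> h ∘ orbit_incl w Phi).
  by move=> i; apply/funext => x; rewrite forget_comp orbit_inclE.
by exists k; rewrite -(kE tt).
Qed.

(** * Systems with measurements *)

Lemma iter_hom_comm (a b : T) (h : hom a b) (f : hom a a) (g : hom b b) n :
  h ∘ f = g ∘ h -> h ∘ iter_hom f n = iter_hom g n ∘ h.
Proof.
move=> hf; elim: n => [|n IHn] /=; first by rewrite hcomph1 hcomp1h.
by rewrite hcompA hf -hcompA IHn hcompA.
Qed.

Section Measurements.
Variable iota : obs_functor T.

Lemma proj_xi (D : dsm iota) n :
  proj _ n ∘ xi D = ds_meas D ∘ iter_hom (ds_map D) n.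
Proof. exact: proj_tuple. Qed.

Lemma shift_xi (D : dsm iota) : shift _ ∘ xi D = xi D ∘ ds_map D.
Proof.
apply: pow_ext => n; rewrite !hcompA proj_shift !proj_xi /=.
by rewrite -hcompA (iter_hom_comm (g := ds_map D)).
Qed.

Lemma pow_hom_xi (D D' : dsm iota) (u : dsm_hom D D') :
  pow_hom (fmap iota (dh_obs u)) ∘ xi D = xi D' ∘ dh_hom u.
Proof.
apply: pow_ext => n; rewrite !hcompA proj_pow_hom -hcompA !proj_xi.
by rewrite hcompA dh_meas -!hcompA (iter_hom_comm _ (dh_equiv u)).
Qed.

Lemma orbit_in_map (D : dsmo iota) :
  exists Phi, orbit_in D ∘ Phi = ds_map D ∘ orbit_in D.
Proof. by apply: orbit_restrict => n y; exists n.+1, y. Qed.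

Lemma orbit_in_hom (D D' : dsmo iota) (u : dsmo_hom D D') :
  exists h, orbit_in D' ∘ h = dh_hom u ∘ orbit_in D.
Proof.
apply: orbit_restrict => n y; exists n, (fmap (forget T) (oh_init u) y).
elim: n => [|n IHn] /=; first by rewrite -!forget_comp oh_orb.
by rewrite -forget_comp dh_equiv forget_comp IHn.
Qed.

Lemma shift_xi_orb (D : dsmo iota) :
  exists Phi, shift _ ∘ xi_orb D = xi_orb D ∘ Phi.
Proof.
have [Phi PhiE] := orbit_in_map D; exists Phi.
by rewrite /xi_orb hcompA shift_xi -!hcompA PhiE.
Qed.

Lemma pow_hom_xi_orb (D D' : dsmo iota) (u : dsmo_hom D D') h :
  orbit_in D' ∘ h = dh_hom u ∘ orbit_in D ->
  pow_hom (fmap iota (dh_obs u)) ∘ xi_orb D = xi_orb D' ∘ h.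
Proof. by move=> hE; rewrite /xi_orb hcompA pow_hom_xi -!hcompA hE. Qed.

Definition dsm_base : functor (DSM iota) T.
Proof.
exists (fun D : DSM iota => iota (ds_obs D))
       (fun _ _ u => fmap iota (dh_obs u)).
by case: (functorP iota) => i1 iM; split=> [D|D D' D'' v u]; rewrite ?i1 ?iM.
Defined.

Definition dsmo_base : functor (DSMO iota) T.
Proof.
exists (fun D : DSMO iota => iota (ds_obs D))
       (fun _ _ u => fmap iota (dh_obs (oh_hom u))).
by case: (functorP iota) => i1 iM; split=> [D|D D' D'' v u]; rewrite ?i1 ?iM.
Defined.

Lemma obs_inducedE (D D' : dsm iota) (u : dsm_hom D D') k :
  obs_induced u k <->
  im_incl (xi D') ∘ k = pow_hom (fmap iota (dh_obs u)) ∘ im_incl (xi D).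
Proof.
by split=> [[]|kE] //; split=> //; exact: im_map_epi (pow_hom_xi u) kE.
Qed.

Lemma obs_orb_inducedE (D D' : dsmo iota) (u : dsmo_hom D D') k :
  obs_orb_induced u k <->
  im_incl (xi_orb D') ∘ k =
    pow_hom (fmap iota (dh_obs u)) ∘ im_incl (xi_orb D).
Proof.
split=> [[h [_ []]]|kE] //; have [h hE] := orbit_in_hom u.
by exists h; split=> //; split=> //; exact: im_map_epi (pow_hom_xi_orb hE) kE.
Qed.

End Measurements.
End Topcat.

Theorem theorem2 (T : topcat) (iota : obs_functor T) :
  (exists (sub : forall D : DSM iota, is_subshift (im_incl (xi D)))
          (Obs : forall D D' : DSM iota, @hom (DSM iota) D D' ->
                   @hom (Seq T) (Subshift (sub D)) (Subshift (sub D'))),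
     @is_functor (DSM iota) (Seq T) (fun D => Subshift (sub D)) Obs /\
     (forall (D D' : DSM iota) (u : @hom (DSM iota) D D')
             (k : @hom T (im (xi D)) (im (xi D'))),
        obs_induced u k <-> k = sh_hom (Obs D D' u))) /\
  (exists (sub : forall D : DSMO iota, is_subshift (im_incl (xi_orb D)))
          (Obs : forall D D' : DSMO iota, @hom (DSMO iota) D D' ->
                   @hom (Seq T) (Subshift (sub D)) (Subshift (sub D'))),
     @is_functor (DSMO iota) (Seq T) (fun D => Subshift (sub D)) Obs /\
     (forall (D D' : DSMO iota) (u : @hom (DSMO iota) D D')
             (k : @hom T (im (xi_orb D)) (im (xi_orb D'))),
        obs_orb_induced u k <-> k = sh_hom (Obs D D' u))).
Proof.
split.
- have [D|D D' u|sub [Obs [ObsF ObsE]]] :=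
    @im_subshift_functor T (DSM iota) (dsm_base iota) (@ds_obj T iota) xi.
  + by exists (ds_map D); exact: shift_xi.
  + by exists (dh_hom u); exact: pow_hom_xi.
  exists sub, Obs; split=> // D D' u k.
  exact: iff_trans (obs_inducedE u k) (ObsE D D' u k).
- have [D|D D' u|sub [Obs [ObsF ObsE]]] :=
    @im_subshift_functor T (DSMO iota) (dsmo_base iota) (@dsmo_orbit T iota)
      xi_orb.
  + exact: shift_xi_orb.
  + by have [h hE] := orbit_in_hom u; exists h; exact: pow_hom_xi_orb.
  exists sub, Obs; split=> // D D' u k.
  exact: iff_trans (obs_orb_inducedE u k) (ObsE D D' u k).
Qed.
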